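(* The ratio $\frac{4}{21}$ cannot be lessened in the statement ''for every planar convex body $A \subset E^2$ and every affine-regular hexagon $H_A$ inscribed in $A$, the centroid of $A$ belongs to the homothetic image of $H_A$ with ratio $\frac{4}{21}$ and center of homothety at the center of $H_A$''. That is, for every real $\lambda$ with $0 \le \lambda < \frac{4}{21}$ there exist a convex body $A \subset E^2$ and an affine-regular hexagon $H_A$ inscribed in $A$, with center $c$, such that the centroid of $A$ does not belong to $\{\, c + \lambda (x-c) : x \in H_A \,\}$.
   Context: $E^2$ is the Euclidean plane. A planar convex body is a closed bounded convex subset of $E^2$ (any such set containing an inscribed affine-regular hexagon has non-empty interior). An affine-regular hexagon is the image of a regular hexagon (as a convex region) under a non-degenerate affine map of the plane; its center is the image of the center of the regular hexagon, i.e. its center of symmetry. A hexagon is inscribed in $A$ if all its vertices lie on the boundary of $A$ (so, by convexity, the hexagon is contained in $A$). The centroid of $A$ is its center of mass with respect to area, $\frac{1}{\mathrm{area}(A)}\int_A x\,dx$. *)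

(* Defs.v *)
From HB Require Import structures.
From mathcomp Require Import all_boot all_order all_algebra.
From mathcomp Require Import all_classical all_reals all_analysis.
Set Implicit Arguments.
Unset Strict Implicit.
Unset Printing Implicit Defensive.
Import Order.TTheory GRing.Theory Num.Theory.
Import numFieldNormedType.Exports.
Local Open Scope classical_set_scope.
Local Open Scope ring_scope.

(* The Euclidean plane is R * R. Its library norm is the sup norm, which has
   the same closed sets, bounded sets and interiors as the Euclidean norm. *)

Definition convex_body (R : realType) (A : set (R * R)) : Prop :=
  [/\ closed A, bounded_set A & convex_set A].

Definition convex_hull (R : realType) (X : set (R * R)) : set (R * R) :=
  smallest (@convex_set R (R * R)%type) X.

Definition boundary (R : realType) (A : set (R * R)) : set (R * R) :=
  closure A `\` interior A.

Definition area (R : realType) (A : set (R * R)) : \bar R :=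
  (lebesgue_measure \x lebesgue_measure)%E A.

(* Meaningful for bounded measurable A of positive area, where the coordinate
   integrals are finite. *)
Definition centroid (R : realType) (A : set (R * R)) : R * R :=
  (fine (area A))^-1 *:
    (\int[(lebesgue_measure \x lebesgue_measure)%E]_(x in A) x.1,
     \int[(lebesgue_measure \x lebesgue_measure)%E]_(x in A) x.2).

Definition nondegenerate_affine (R : realType) (g : R * R -> R * R) : Prop :=
  exists (f : {linear (R * R)%type -> (R * R)%type}) (t : R * R),
    bijective f /\ forall x, g x = f x + t.

(* Vertices of the regular hexagon with center o, circumradius r and first
   vertex in direction theta. *)
Definition regular_hexagon_vertices (R : realType) (o : R * R) (r theta : R) :
    set (R * R) :=
  range (fun k : 'I_6 =>
    o + r *: (cos (theta + k%:R * (pi / 3)), sin (theta + k%:R * (pi / 3)))).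

Definition regular_hexagon (R : realType) (o : R * R) (r theta : R) :
    set (R * R) :=
  convex_hull (regular_hexagon_vertices o r theta).

(* The region H is an affine-regular hexagon with vertex set V and center c. *)
Definition affine_regular_hexagon (R : realType) (H V : set (R * R))
    (c : R * R) : Prop :=
  exists (g : R * R -> R * R) (o : R * R) (r theta : R),
    [/\ nondegenerate_affine g, 0 < r,
        H = g @` regular_hexagon o r theta,
        V = g @` regular_hexagon_vertices o r theta & c = g o].

Definition homothety (R : realType) (c : R * R) (lambda : R) (x : R * R) :
    R * R :=
  c + lambda *: (x - c).

(* Main.v *)
Require Import Defs.
From HB Require Import structures.
From mathcomp Require Import all_boot all_order all_algebra.
From mathcomp Require Import all_classical all_reals all_analysis.
From mathcomp Require Import ring lra.
Import Order.TTheory GRing.Theory Num.Theory.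
Import numFieldNormedType.Exports.
Local Open Scope classical_set_scope.
Local Open Scope ring_scope.

(* In suitable affine coordinates the hexagon has vertices (+-1, +-1) and
   (0, +-2), that is H = {|s| + |t| <= 2, |s| <= 1}. Take for A the hexagon
   together with the triangle cut off by the side s = 1 and the prolongations of
   its two neighbours, so A = {|s| + |t| <= 2, -1 <= s}. All six vertices of H
   lie on |s| + |t| = 2, hence on the boundary of A. The sections of A at fixed
   s have length 4 - 2|s| for -1 <= s <= 2, so the area of A is 7, its moment in
   s is 4/3, and its centroid has s = 4/21, whereas s <= lambda on the homothetic
   image of H. *)

(** * Integration tools: Fubini by sections, primitives of polynomials *)

(** Fubini: for fixed [x] the inner integrand is the constant [f x] on the section and 0 off it. *)
Lemma Rintegral_prod_fst (R : realType) (d1 d2 : measure_display)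
    (T1 : measurableType d1) (T2 : measurableType d2)
    (m1 : {sigma_finite_measure set T1 -> \bar R})
    (m2 : {sigma_finite_measure set T2 -> \bar R})
    (A : set (T1 * T2)) (f : T1 -> R) :
  measurable A -> (forall x, (m2 (xsection A x) < +oo)%E) ->
  (m1 \x m2)%E.-integrable A (EFin \o (f \o fst)) ->
  \int[(m1 \x m2)%E]_(z in A) f z.1 =
  \int[m1]_x (f x * fine (m2 (xsection A x))).
Proof.
move=> mA fin_sec fA.
rewrite Rintegral_mkcond /Rintegral -integral12_prod_meas1; last first.
  rewrite -[X in _.-integrable _ X](restrict_EFin (f \o fst)).
  exact: (integrable_mkcond _ mA).1.
congr fine; apply: eq_integral => x _.
rewrite EFinM fineK ?ge0_fin_numE//.
rewrite -integral_cst; last exact: measurable_xsection.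
rewrite [RHS]integral_mkcond; apply: eq_integral => y _ /=.
by rewrite !patchE mem_xsection; case: ifPn.
Qed.

Lemma Rintegral_deriv_horner (R : realType) (p : {poly R}) (a b : R) : a < b ->
  \int[lebesgue_measure]_(x in `[a, b]) p^`().[x] = p.[b] - p.[a].
Proof.
move=> ab; rewrite /Rintegral (@continuous_FTC2 _ _ (horner p))//.
- by apply: continuous_subspaceT => x; exact: continuous_horner.
- split=> [x _||].
  + exact: derivable_horner.
  + by apply: cvg_at_right_filter; exact: continuous_horner.
  + by apply: cvg_at_left_filter; exact: continuous_horner.
- by move=> x _; rewrite derivE.
Qed.

(** * Trigonometry of the regular hexagon *)

(** With c = cos (pi / 3), expanding cos pi = -1 as a triple angle gives 4c^3 - 3c + 1 = (c + 1)(2c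
    - 1)^2 = 0, and c > 0 rules out c = -1. *)
Lemma cos_pi3 (R : realType) : cos (pi / 3) = 2^-1 :> R.
Proof.
have p0 := pi_gt0 R.
have c0 : 0 < cos (pi / 3 :> R) by apply: cos_gt0_pihalf; apply/andP; split; lra.
have := cospi R.
rewrite [X in cos X](_ : pi = pi / 3 + pi / 3 + pi / 3); last by lra.
rewrite cosD cosD sinD.
have := cos2Dsin2 (pi / 3 : R).
move: (cos _) (sin _) c0 => c s c0 h1 h2.
have : (c + 1) * (2 * c - 1) ^+ 2 = 0.
  transitivity ((c * c - s * s) * c - (s * c + c * s) * s + 1
    + 3 * c * (c ^+ 2 + s ^+ 2 - 1)); first by ring.
  by rewrite h1 h2; ring.
by move=> /eqP; rewrite mulf_eq0 expf_eq0/= => /orP[|] /eqP; lra.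
Qed.

Lemma sin_pi3_gt0 (R : realType) : 0 < sin (pi / 3) :> R.
Proof. have p0 := pi_gt0 R; apply: sin_gt0_pi; apply/andP; split; lra. Qed.

(* (u, v) is a vertex of the regular hexagon in the coordinates in which the
   hexagon has vertices (+-1, +-1) and (0, +-2); rotation by pi / 3 acts there
   as (u, v) |-> ((u + v) / 2, (v - 3 u) / 2). *)
Lemma hexagon_angle (R : realType) (k : nat) :
  let u := sin (k%:R * (pi / 3)) / sin (pi / 3) : R in
  let v := 2 * cos (k%:R * (pi / 3)) : R in
  (`|u| = 1 /\ `|v| = 1) \/ (u = 0 /\ `|v| = 2).
Proof.
have s0 := sin_pi3_gt0 R.
elim: k => [|k IH] /=; first by right; rewrite !mul0r sin0 cos0 mul0r mulr1 ger0_norm.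
rewrite -natr1 mulrDl mul1r sinD cosD cos_pi3.
move: IH => /=; have := cos2Dsin2 (pi / 3 : R); rewrite cos_pi3.
move: (sin (pi / 3)) s0 (sin (k%:R * _)) (cos _) => s s0 x v s2.
have -> : (x * 2^-1 + v * s) / s = (x / s + 2 * v) / 2 by field; rewrite gt_eqF.
have -> : 2 * (v * 2^-1 - x * s) = (2 * v - 3 * (x / s)) / 2.
  (* Since sin^2 (pi / 3) = 3/4, the rotation has rational coefficients in the coordinates (u,
     v). *)
  have -> : x * s = 3 / 4 * (x / s); last by field; rewrite gt_eqF.
  have -> : 3 / 4 = s ^+ 2 :> R by lra.
  by field; rewrite gt_eqF.
move: (x / s) (2 * v) => {x v s s0 s2} u v.
have normE (x y : R) : 0 <= y -> (x - y) * (x + y) = 0 -> `|x| = y.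
  move=> y0 /eqP; rewrite mulf_eq0 subr_eq0 addr_eq0.
  by case/orP => /eqP ->; rewrite ?normrN ger0_norm.
case=> -[].
(* Among the vertices (+-1, +-1), those with equal signs go to (+-1, -+1), those with opposite signs
   to (0, +-2). *)
- do 2![move/eqP; rewrite eqr_norml => /andP[/orP[] /eqP -> _]];
    by [left; split; apply: normE; lra | right; split; [lra | apply: normE; lra]].
- move=> ->; move/eqP; rewrite eqr_norml => /andP[/orP[] /eqP -> _];
    by left; split; apply: normE; lra.
Qed.

(** * The body: convexity and boundary points *)

Definition truncated_diamond (R : realType) : set (R * R) :=
  [set z | `|z.1| + `|z.2| <= 2 /\ -1 <= z.1].

Lemma truncated_diamond_convex_body (R : realType) :
  convex_body (@truncated_diamond R).
Proof.
split.
- apply: closedI.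
    apply: (@preimage_closed _ _ (fun z : R * R => `|z.1| + `|z.2|)
      [set x | x <= 2]).
      move=> z _; apply: cvgD.
        by apply: cvg_norm; exact: cvg_fst.
      by apply: cvg_norm; exact: cvg_snd.
    exact: closed_le.
  apply: (@preimage_closed _ _ (@fst R R) [set x | -1 <= x]).
    by move=> z _; exact: cvg_fst.
  exact: (@closed_ge R (-1)).
- exists 2; split; rewrite ?num_real// => M M2 [x y] [/= xy _].
  have x0 := normr_ge0 x; have y0 := normr_ge0 y.
  by rewrite /Num.norm/= ge_max; apply/andP; split; lra.
- move=> [a b] [c d] l; rewrite !inE => -[/= ab a1] [/= cd c1].
  have l0 : 0 <= l%:num by [].
  have l1 : 0 <= 1 - l%:num by rewrite subr_ge0.
  split => /=; last first.
    have := ler_wpM2l l0 a1; have := ler_wpM2l l1 c1.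
    by rewrite /GRing.scale/= /unstable.onem; lra.
  have := ler_wpM2l l0 ab; have := ler_wpM2l l1 cd.
  have := ler_normD (l%:num * a) ((1 - l%:num) * c).
  have := ler_normD (l%:num * b) ((1 - l%:num) * d).
  rewrite !normrM (ger0_norm l0) (ger0_norm l1).
  by rewrite /GRing.scale/= /unstable.onem; lra.
Qed.

Lemma truncated_diamond_boundary (R : realType) (z : R * R) :
  `|z.1| + `|z.2| = 2 -> -1 <= z.1 -> boundary (@truncated_diamond R) z.
Proof.
move=> z2 z1; split; first by apply: subset_closure; split; rewrite ?z2.
(* Stretching [z] by 1 + e/4 moves each coordinate by at most e/2, as both are at most 2 in absolute
   value, yet pushes |s| + |t| above 2. *)
rewrite /interior => /nbhs_ballP[e /= e0 /(_ ((1 + e / 4) *: z))].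
have p : 0 <= 1 + e / 4 by lra.
have ze (x : R) : `|x - (1 + e / 4) * x| = e / 4 * `|x|.
  have -> : x - (1 + e / 4) * x = - (e / 4 * x) by ring.
  by rewrite normrN normrM [`|e / 4|]ger0_norm//; lra.
have n1 := normr_ge0 z.1; have n2 := normr_ge0 z.2.
case=> [|/= + _]; last by rewrite !normrM ger0_norm// -mulrDr z2; lra.
by split; rewrite /= -ball_normE /ball_/= /GRing.scale/= ze; nra.
Qed.

(** * Area and first moment of the body *)

Lemma truncated_diamond_measurable (R : realType) :
  measurable (@truncated_diamond R).
Proof.
have -> : @truncated_diamond R =
    (setT `&` [set z : R * R | `|z.1| + `|z.2| <= 2]) `&` [set z | -1 <= z.1].
  by rewrite setTI.
have m1 : measurable_fun setT (@fst R R) by exact: measurable_fst.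
have m2 : measurable_fun setT (@snd R R) by exact: measurable_snd.
apply: measurable_fun_le.
- apply: measurable_fun_le => //.
  by apply: measurable_realfun.measurable_funD; exact: measurableT_comp.
- by [].
- exact: measurable_funTS.
Qed.

Lemma truncated_diamond_measure_lty (R : realType) :
  (area (@truncated_diamond R) < +oo)%E.
Proof.
have h : @truncated_diamond R `<=` `[-2, 2] `*` `[-2, 2].
  move=> [x y] [/= xy _]; have := normr_ge0 x; have := normr_ge0 y => y0 x0.
  by split; rewrite /= in_itv/= -ler_norml; lra.
rewrite /area; apply: (@le_lt_trans _ _
    ((lebesgue_measure \x lebesgue_measure)%E (`[-2, 2] `*` `[-2, 2]))).
  apply: le_measure => //; rewrite inE.
  - exact: truncated_diamond_measurable.
  - exact: measurableX.
rewrite product_measure1E//.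
have /= -> := @lebesgue_measure_itv R `[-2, 2].
rewrite lte_fin ifT; last by lra.
by rewrite -EFinD -EFinM ltry.
Qed.

Lemma truncated_diamond_xsection (R : realType) (s : R) :
  lebesgue_measure (xsection (@truncated_diamond R) s) =
  (((fun x : R => 4 - 2 * `|x| : R) \_ `[-1, 2]) s)%:E.
Proof.
rewrite patchE; case: ifPn; rewrite ?notin_setE ?inE/= in_itv/= => s12.
  have -> : xsection (@truncated_diamond R) s =
      `[- (2 - `|s|), 2 - `|s|]%classic.
    rewrite eqEsubset; split=> t; rewrite /xsection/= inE/= in_itv/= -ler_norml.
      by case=> /= ? _; lra.
    by move=> ?; split => /=; lra.
  have : `|s| <= 2 by rewrite ler_norml; lra.
  (* The second case is the degenerate section at s = 2, a single point, where 4 - 2|s| is also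
     0. *)
  rewrite lebesgue_measure_itv/= lte_fin; case: ifPn => h1 h2.
    by rewrite -EFinD; congr EFin; lra.
  by congr EFin; lra.
rewrite (_ : xsection _ _ = set0) ?measure0//; apply/seteqP; split => // t.
rewrite /xsection/= inE => -[/= h1 h2]; apply: s12; rewrite h2/=.
by have := ler_norm s; have := normr_ge0 t; lra.
Qed.

Lemma truncated_diamond_Rintegral (R : realType) (f : {poly R}) :
  \int[(lebesgue_measure \x lebesgue_measure)%E]_(z in @truncated_diamond R)
    f.[z.1] =
  \int[lebesgue_measure]_(s in `[-1, 2]) (f.[s] * (4 - 2 * `|s|)).
Proof.
(* Boundedness on [-2, 2] together with finite area yields the integrability that Fubini
   requires. *)
have bf : exists M, forall x : R, `|x| <= 2 -> `|f.[x]| <= M.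
  have := @segment_compact R (-2) 2.
  move=> /(@continuous_compact _ _ (horner f)) => /(_ _)/compact_bounded.
  case.
    by apply: continuous_subspaceT => x; exact: continuous_horner.
  move=> M [_ /(_ (M + 1))] H; exists (M + 1) => x x2.
  by apply: H; rewrite ?ltrDl//; exists x => //=; rewrite in_itv/= -ler_norml.
have mf : measurable_fun setT (horner f).
  by apply: measurable_realfun.continuous_measurable_fun => x; exact: continuous_horner.
rewrite (@Rintegral_prod_fst R _ _ _ _ lebesgue_measure lebesgue_measure _
  (horner f)).
- rewrite [RHS]Rintegral_mkcond; apply: eq_Rintegral => s _.
  have /= -> := truncated_diamond_xsection R s; rewrite !patchE.
  case: ifPn => // _.
  by rewrite mulr0.
- exact: truncated_diamond_measurable.
- by move=> x; have /= -> := truncated_diamond_xsection R x; rewrite ltry.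
- apply: measurable_bounded_integrable.
  + exact: truncated_diamond_measurable.
  + exact: truncated_diamond_measure_lty.
  + by apply: measurable_funTS; apply: measurableT_comp.
  + case: bf => M bM; exists M; split; rewrite ?num_real// => N MN [x y] [/= xy _].
    by apply/(le_trans _ (ltW MN))/bM; have := normr_ge0 y; lra.
Qed.

(** Meant for integrands containing [|x|], which are polynomial only on each side of a break point:
    the fundamental theorem applies to each piece, and the shared endpoint is a null set. *)
Lemma Rintegral_piecewise_deriv_horner (R : realType) (p q : {poly R})
    (f : R -> R) (a b c : R) :
  a < c -> c < b -> {within `[a, b], continuous f} ->
  {in `[a, c], f =1 horner p^`()} -> {in `[c, b], f =1 horner q^`()} ->
  \int[lebesgue_measure]_(x in `[a, b]) f x = p.[c] - p.[a] + (q.[b] - q.[c]).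
Proof.
move=> ac cb cf fp fq.
have iab : lebesgue_measure.-integrable `[a, b] (EFin \o f).
  by apply: continuous_compact_integrable => //; exact: segment_compact.
have icb : lebesgue_measure.-integrable `[c, b] (EFin \o f).
  by apply: integrableS iab => //; apply: subset_itvr; rewrite bnd_simp ltW.
have := @Rintegral_itvB R f (BLeft a) (BRight b) c iab.
rewrite !bnd_simp => /(_ (ltW ac) (ltW cb)).
rewrite [X in _ = X -> _]Rintegral_itv_obnd_cbnd; last first.
  by apply: integrableS icb => //; apply: subset_itvr; rewrite bnd_simp.
have -> : \int[lebesgue_measure]_(x in `[a, c]) f x = p.[c] - p.[a].
  by rewrite -Rintegral_deriv_horner//; apply: eq_Rintegral => x; rewrite inE => /fp.
have -> : \int[lebesgue_measure]_(x in `[c, b]) f x = q.[b] - q.[c].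
  by rewrite -Rintegral_deriv_horner//; apply: eq_Rintegral => x; rewrite inE => /fq.
lra.
Qed.

(** The section length is 4 + 2s left of 0 and 4 - 2s right of it. Taking f = 1 gives the area, f =
    'X the first moment. *)
Lemma truncated_diamond_moment (R : realType) (f p q : {poly R}) :
  (forall x, p^`().[x] = f.[x] * (4 + 2 * x)) ->
  (forall x, q^`().[x] = f.[x] * (4 - 2 * x)) ->
  \int[(lebesgue_measure \x lebesgue_measure)%E]_(z in @truncated_diamond R)
    f.[z.1] = p.[0] - p.[-1] + (q.[2] - q.[0]).
Proof.
move=> dp dq; rewrite truncated_diamond_Rintegral.
apply: Rintegral_piecewise_deriv_horner => [|||x|x]; try lra.
- apply: continuous_subspaceT => x; apply: cvgM; first exact: continuous_horner.
  by apply: cvgB; [exact: cvg_cst | apply: cvgMr; exact: norm_continuous].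
- by rewrite in_itv/= => /andP[_ x0]; rewrite dp ler0_norm// mulrN opprK.
- by rewrite in_itv/= => /andP[x0 _]; rewrite dq ger0_norm.
Qed.

Lemma centroid_truncated_diamond (R : realType) :
  (centroid (@truncated_diamond R)).1 = 4 / 21.
Proof.
rewrite /centroid /= /GRing.scale/=.
have -> : fine (area (@truncated_diamond R)) = 7.
  rewrite -[LHS]mul1r /area.
  rewrite -(@Rintegral_cst _ _ _ (lebesgue_measure \x lebesgue_measure)%E);
    last exact: truncated_diamond_measurable.
  (* Primitives of 4 + 2x and 4 - 2x; the two sides contribute 3 and 4. *)
  have := truncated_diamond_moment R 1 (4 *: 'X + 'X^2) (4 *: 'X - 'X^2).
  under eq_Rintegral do rewrite hornerC.
  by move=> ->; rewrite ?hornerE => *; rewrite ?poly.derivE ?hornerE /=; lra.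
(* Primitives of x(4 + 2x) and x(4 - 2x); the two sides contribute -4/3 and 8/3. *)
have := truncated_diamond_moment R 'X (2 *: 'X^2 + (2 / 3) *: 'X^3)
  (2 *: 'X^2 - (2 / 3) *: 'X^3).
under eq_Rintegral do rewrite hornerX.
by move=> ->; rewrite ?hornerE => *; rewrite ?poly.derivE ?hornerE /=; lra.
Qed.

(** * The affine image of the hexagon and the conclusion *)

Lemma nondegenerate_affine_swap_scale (R : realType) (a b : R) :
  a != 0 -> b != 0 -> nondegenerate_affine (fun z : R * R => (a * z.2, b * z.1)).
Proof.
move=> a0 b0.
pose g (z : R * R) : R * R := (a * z.2, b * z.1).
have g_lin : linear g.
  by move=> k [x y] [z t]; congr pair; rewrite /GRing.scale/= ?/GRing.scale/=; ring.
pose f : {linear (R * R)%type -> (R * R)%type} :=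
  HB.pack g (GRing.isLinear.Build R (R * R)%type (R * R)%type *:%R g g_lin).
exists f, 0; split; last by move=> x; rewrite addr0.
exists (fun z => (z.2 / b, z.1 / a)) => -[x y] /=; rewrite /g/=.
  by congr pair; field.
by congr pair; field.
Qed.

Lemma convex_halfplane_snd (R : realType) (b : R) :
  convex_set [set y : R * R | y.2 <= b].
Proof.
move=> [x y] [z t] l; rewrite !inE /= => yb tb.
have l0 : 0 <= l%:num by [].
have l1 : 0 <= 1 - l%:num by rewrite subr_ge0.
have := ler_wpM2l l0 yb; have := ler_wpM2l l1 tb.
by rewrite /GRing.scale/= /unstable.onem; lra.
Qed.

Theorem mainTheorem2 (R : realType) (lambda : R)
    (lambda_ge0 : 0 <= lambda) (lambda_lt : lambda < 4 / 21) :
  exists (A H V : set (R * R)) (c : R * R),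
    [/\ convex_body A,
        affine_regular_hexagon H V c,
        V `<=` boundary A
      & ~ (homothety c lambda @` H) (centroid A)].
Proof.
have s0 := sin_pi3_gt0 R.
(* The swap sends the vertices (+-1, 0) of the regular hexagon to (0, +-2); the scaling sends the
   other four to (+-1, +-1). *)
pose g (z : R * R) := ((sin (pi / 3))^-1 * z.2, 2 * z.1).
exists (@truncated_diamond R), (g @` regular_hexagon 0 1 0),
  (g @` regular_hexagon_vertices 0 1 0), 0; split.
- exact: truncated_diamond_convex_body.
- exists g, 0, 1, 0; split => //; last by rewrite /g /= !mulr0.
  by apply: nondegenerate_affine_swap_scale; rewrite ?invr_eq0 ?gt_eqF//.
- move=> _ [_ [k _ <-] <-]; rewrite add0r scale1r add0r /g/=.
  have := hexagon_angle R k; rewrite /= [_ / sin (pi / 3)]mulrC.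
  move=> [[u v]|[u v]]; apply: truncated_diamond_boundary => /=.
  + by rewrite u v; lra.
  + by move: u => /eqP; rewrite eqr_norml => /andP[/orP[] /eqP -> _]; lra.
  + by rewrite u v normr0; lra.
  + by rewrite u; lra.
- move=> [_ [z Hz <-]] /(congr1 fst).
  rewrite centroid_truncated_diamond /homothety/= /GRing.scale/= add0r subr0.
  (* If s <= 1 on the hexagon, then s <= [lambda] < 4/21 on its homothetic image. *)
  suff : (sin (pi / 3))^-1 * z.2 <= 1 by nra.
  rewrite mulrC ler_pdivrMr// mul1r.
  (* By minimality of the hull, a convex half-plane containing the six vertices contains the
     hexagon. *)
  apply: (@smallest_sub _ _ _ [set y : R * R | y.2 <= sin (pi / 3)] _ _ _ Hz).
    exact: convex_halfplane_snd.
  move=> _ [k _ <-]; rewrite add0r scale1r add0r/=.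
  have := hexagon_angle R k; rewrite /= => uv.
  rewrite -[leRHS]mul1r -ler_pdivrMr//; apply: (le_trans (ler_norm _)).
  by case: uv => -[-> _]//; rewrite normr0.
Qed.
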